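(* Let $S$ be the sylvester monoid, presented by $\langle A \mid \mathcal{R}\rangle$ with $A=\{1<2<3<\cdots\}$ and $\mathcal{R}=\{(cavb,acvb) : a,b,c\in A,\ a\le b<c,\ v\in A^*\}$. Then two elements of $S$ are $o$-conjugate in $S$ if and only if they have the same content (when viewed as words over $A$). Moreover, $o$-conjugacy is decidable for $S$ (that is, there is an algorithm that takes as input two words over $A$ and decides whether the elements of $S$ they represent are $o$-conjugate), and the relations $\sim_o$ and $\sim_p^*$ on $S$ are equal.
   Context: $A^*$ is the free monoid on the infinite ordered alphabet $A=\{1<2<3<\cdots\}$; $\langle A\mid\mathcal{R}\rangle$ is the monoid $A^*/\equiv$, where $\equiv$ is the congruence generated by $\mathcal{R}$. The content of a word $u\in A^*$ is the function $A\to\mathbb{N}\cup\{0\}$, $a\mapsto |u|_a$, where $|u|_a$ is the number of occurrences of the symbol $a$ in $u$. Both sides of each relation in $\mathcal{R}$ have the same content, so all words representing a given element of $S$ have the same content, and this common function is the content of the element. For a monoid $M$ and $x,y\in M$: - $x\sim_o y$ ($x$ and $y$ are $o$-conjugate) iff there exist $g,h\in M$ with $xg=gy$ and $hx=yh$. - $x\sim_p y$ iff there exist $u,v\in M$ with $x=uv$ and $y=vu$. - $\sim_p^*$ is the transitive closure of $\sim_p$. *)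

(* Defs.v *)
From HB Require Import structures.
From Stdlib Require Export Relation_Operators.
From mathcomp Require Export all_boot.
From mathcomp Require Export generic_quotient boolp.

Set Implicit Arguments.
Unset Strict Implicit.
Unset Printing Implicit Defensive.

Local Open Scope group_scope.
Local Open Scope quotient_scope.

Section Conjugacy.
Variable M : monoidType.

Definition o_conj (x y : M) : Prop :=
  exists g h : M, x * g = g * y /\ h * x = y * h.

Definition p_conj (x y : M) : Prop :=
  exists u v : M, x = u * v /\ y = v * u.

Definition p_conj_star : M -> M -> Prop := clos_trans M p_conj.

End Conjugacy.

Section Presentation.
Variables (T : choiceType) (R : seq T -> seq T -> Prop).

Inductive cong : seq T -> seq T -> Prop :=
| cong_gen u v : R u v -> cong u v
| cong_refl u : cong u u
| cong_sym u v : cong u v -> cong v u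
| cong_trans u v w : cong u v -> cong v w -> cong u w
| cong_cat u u' v v' : cong u u' -> cong v v' -> cong (u ++ v) (u' ++ v').

Definition congb : rel (seq T) := fun u v => `[< cong u v >].

Lemma congb_refl : reflexive congb.
Proof. by move=> u; apply/asboolP; exact: cong_refl. Qed.

Lemma congb_sym : symmetric congb.
Proof. by move=> u v; apply/asboolP/asboolP; exact: cong_sym. Qed.

Lemma congb_trans : transitive congb.
Proof.
by move=> v u w /asboolP uv /asboolP vw; apply/asboolP; exact: cong_trans vw.
Qed.

Definition cong_equiv : equiv_rel (seq T) :=
  EquivRel congb congb_refl congb_sym congb_trans.

Definition presented := {eq_quot cong_equiv}.
HB.instance Definition _ := Choice.on presented.
HB.instance Definition _ := Quotient.on presented.

Definition wclass (u : seq T) : presented := \pi u.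

Lemma wclassP u v : wclass u = wclass v <-> cong u v.
Proof.
by split=> [/eqmodP/asboolP|uv] //; apply/eqmodP/asboolP.
Qed.

Lemma repr_wclass u : cong (repr (wclass u)) u.
Proof. by apply/wclassP; rewrite /wclass reprK. Qed.

Definition presented_mul (x y : presented) : presented :=
  wclass (repr x ++ repr y).

Lemma presented_mulE u v :
  presented_mul (wclass u) (wclass v) = wclass (u ++ v).
Proof. by apply/wclassP; apply: cong_cat; exact: repr_wclass. Qed.

Lemma wclass_ind (P : presented -> Prop) :
  (forall u, P (wclass u)) -> forall x, P x.
Proof. by move=> Pw x; rewrite -[x]reprK; exact: Pw. Qed.

Lemma presented_mulA : associative presented_mul.
Proof.
elim/wclass_ind=> u; elim/wclass_ind=> v; elim/wclass_ind=> w.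
by rewrite !presented_mulE catA.
Qed.

Lemma presented_mul1g : left_id (wclass [::]) presented_mul.
Proof. by elim/wclass_ind=> u; rewrite presented_mulE. Qed.

Lemma presented_mulg1 : right_id (wclass [::]) presented_mul.
Proof. by elim/wclass_ind=> u; rewrite presented_mulE cats0. Qed.

HB.instance Definition _ := isMonoid.Build presented
  presented_mulA presented_mul1g presented_mulg1.

Lemma wclassM u v : wclass (u ++ v) = wclass u * wclass v.
Proof. by rewrite -presented_mulE. Qed.

Lemma wclass1 : wclass [::] = 1.
Proof. by []. Qed.

End Presentation.

Notation letter := {n : nat | 0 < n}.

Inductive syl_rel : seq letter -> seq letter -> Prop :=
| Syl_rel (a b c : letter) (v : seq letter) :
    val a <= val b -> val b < val c ->
    syl_rel (c :: a :: v ++ [:: b]) (a :: c :: v ++ [:: b]).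

Notation sylvester := (presented syl_rel).
Notation sylv_of := (@wclass _ syl_rel).

Definition word_content (u : seq letter) (a : letter) : nat := count_mem a u.

(* The choice of representative is immaterial, see content_sylv_of. *)
Definition content (x : sylvester) : letter -> nat := word_content (repr x).

Lemma cong_content u v : cong syl_rel u v -> word_content u =1 word_content v.
Proof.
elim=> {u v} [_ _ [a b c v _ _] d|//|u v _ uv d|u v w _ uv _ vw d
             |u u' v v' _ uu' _ vv' d] //.
- by rewrite /word_content /= addnCA.
- by rewrite uv vw.
- by rewrite /word_content !count_cat; congr addn; [exact: uu'|exact: vv'].
Qed.

Lemma content_sylv_of u : content (sylv_of u) =1 word_content u.
Proof. exact/cong_content/repr_wclass. Qed.

(* Terms for partial recursive functions of n natural-number arguments:       *)
(* [rprec f g] recurses on the first argument, with [g] receiving the counter *)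
(* and the previous value before the parameters; [rmin f] searches for the    *)
(* least zero of [f] in its first argument.                                   *)
Inductive recf : nat -> Type :=
| rzero n : recf n
| rsucc : recf 1
| rproj n (i : 'I_n) : recf n
| rcomp m n (f : recf m) (g : 'I_m -> recf n) : recf n
| rprec n (f : recf n) (g : recf n.+2) : recf n.+1
| rmin n (f : recf n.+1) : recf n.

(* [eval f v y]: the function denoted by [f] is defined at [v] with value [y]. *)
Fixpoint eval n (f : recf n) : n.-tuple nat -> nat -> Prop :=
  match f in recf n return n.-tuple nat -> nat -> Prop with
  | rzero _ => fun _ y => y = 0
  | rsucc => fun v y => y = (thead v).+1
  | rproj _ i => fun v y => y = tnth v i
  | rcomp m _ f g => fun v y =>
      exists w : m.-tuple nat,
        (forall i, eval (g i) v (tnth w i)) /\ eval f w y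
  | rprec _ f g => fun v y =>
      exists s : nat -> nat,
        [/\ eval f [tuple of behead v] (s 0),
            forall i, i < thead v ->
              eval g [tuple of i :: s i :: behead v] (s i.+1)
          & y = s (thead v)]
  | rmin _ f => fun v y =>
      eval f [tuple of y :: v] 0 /\
      forall z, z < y -> exists k, eval f [tuple of z :: v] k.+1
  end.

Lemma eval_functional n (f : recf n) v y y' :
  eval f v y -> eval f v y' -> y = y'.
Proof.
elim: f v y y' => {n} /=.
- by move=> n v y y' -> ->.
- by move=> v y y' -> ->.
- by move=> n i v y y' -> ->.
- move=> m n f IHf g IHg v y y' [w [gw fw]] [w' [gw' fw']].
  have ww' : w = w' by apply: eq_from_tnth => i; exact: IHg (gw i) (gw' i).
  by rewrite ww' in fw; exact: IHf fw fw'.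
- move=> n f IHf g IHg v y y' [s [s0 sS ->]] [s' [s0' sS' ->]].
  suff ss' i : i <= thead v -> s i = s' i by exact: ss'.
  elim: i => [_|i IHi ltiv]; first exact: IHf s0 s0'.
  have := sS i ltiv; rewrite (IHi (ltnW ltiv)) => gi.
  exact: IHg gi (sS' i ltiv).
- move=> n f IHf v y y' [fy miny] [fy' miny'].
  case: (ltngtP y y') => // [/miny'|/miny] [k fk].
  + by have := IHf _ _ _ fy fk.
  + by have := IHf _ _ _ fy' fk.
Qed.

(* [CodeSeq.code] is the library's effective bijection from seq nat to nat. *)
Definition code_word (u : seq letter) : nat := CodeSeq.code (map val u).

(* The axioms in force make every predicate boolean-valued, so decidability   *)
(* means that some recursive function, total on codes of words, computes it.  *)
Definition word_decidable (P : seq letter -> seq letter -> Prop) : Prop :=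
  exists f : recf 2, forall u v : seq letter,
    (P u v -> eval f [tuple code_word u; code_word v] 1) /\
    (~ P u v -> eval f [tuple code_word u; code_word v] 0).

(* Main.v *)
(* If x g = g y then x and y have the same content, since contents add up and
   cancel.  Conversely, cyclic shifts sort every word: if s ++ x ++ b :: y
   satisfies s <= b < x letterwise, the later letter b lets s and x commute, so
   this word is congruent to x ++ s ++ b :: y, whose cyclic shift
   s ++ b :: y ++ x has a longer prefix of smallest letters.  As p-conjugate
   elements are o-conjugate, both relations coincide with equality of content.
   Decidability is then the computability of letter counts: the code of a word
   lists, in binary and from the least significant bit, the letter n as n zeros
   followed by a one. *)
Require Import Defs.

Set Implicit Arguments.
Unset Strict Implicit.
Unset Printing Implicit Defensive.

(** * Conjugacy relations in an arbitrary monoid *)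

Section Conjugacy.
Variable M : monoidType.
Local Open Scope group_scope.

Lemma p_conj_sym (x y : M) : p_conj x y -> p_conj y x.
Proof. by move=> [u [v [-> ->]]]; exists v, u. Qed.

Lemma p_conj_star_refl (x : M) : p_conj_star x x.
Proof. by apply: t_step; exists x, 1; rewrite mulg1 mul1g. Qed.

Lemma p_conj_star_sym (x y : M) : p_conj_star x y -> p_conj_star y x.
Proof.
elim=> {x y} [x y /p_conj_sym|x y z _ yx _ zy]; first exact: t_step.
exact: t_trans zy yx.
Qed.

Lemma p_conj_o_conj (x y : M) : p_conj x y -> o_conj x y.
Proof. by move=> [u [v [-> ->]]]; exists u, v; rewrite !mulgA. Qed.

Lemma o_conj_trans (x y z : M) : o_conj x y -> o_conj y z -> o_conj x z.
Proof.
move=> [g [h [xg hx]]] [g' [h' [yg hy]]]; exists (g * g'), (h' * h).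
by rewrite mulgA xg -!mulgA yg hx !mulgA hy.
Qed.

Lemma p_conj_star_o_conj (x y : M) : p_conj_star x y -> o_conj x y.
Proof.
elim=> {x y} [x y|x y z _ xy _ yz]; first exact: p_conj_o_conj.
exact: o_conj_trans xy yz.
Qed.

End Conjugacy.

Lemma p_conj_wclass_catC (T : choiceType) (R : seq T -> seq T -> Prop) u v :
  p_conj (wclass R (u ++ v)) (wclass R (v ++ u)).
Proof. by exists (wclass R u), (wclass R v); rewrite !wclassM. Qed.

(** * Content as an invariant of o-conjugacy *)

Lemma content_mulg (x y : sylvester) a :
  content (x * y)%g a = content x a + content y a.
Proof.
elim/wclass_ind: x => u; elim/wclass_ind: y => v.
by rewrite -wclassM !content_sylv_of /word_content count_cat.
Qed.

Lemma o_conj_content (x y : sylvester) : o_conj x y -> content x =1 content y.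
Proof.
move=> [g [_ [xg _]]] a; have := congr1 (content^~ a) xg.
by rewrite !content_mulg addnC => /addnI.
Qed.

(** * Sorting words by cyclic shifts *)

(** The large letter [c] passes the letters of [s] one at a time, from the last to the first; the
    same later [b] licenses every exchange. *)
Lemma syl_cong_move (c b : letter) s v y :
    (forall a, a \in s -> val a <= val b) -> val b < val c ->
  cong syl_rel (s ++ c :: v ++ b :: y) (c :: s ++ v ++ b :: y).
Proof.
elim: s => [|a s IHs] sb bc /=; first exact: cong_refl.
apply: (@cong_trans _ _ _ (a :: c :: s ++ v ++ b :: y)).
  apply: (@cong_cat _ _ [:: a] [:: a]); first exact: cong_refl.
  by apply: IHs => // d ds; apply: sb; rewrite inE ds orbT.
(* One use of the defining relation, with middle word [s ++ v] and last letter [b]; the suffix [y]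
   is carried along. *)
have := @cong_cat _ syl_rel (a :: c :: (s ++ v) ++ [:: b])
  (c :: a :: (s ++ v) ++ [:: b]) y y.
rewrite /= -!catA; apply; last exact: cong_refl.
rewrite !catA; apply/cong_sym/cong_gen/Syl_rel => //.
by apply: sb; rewrite mem_head.
Qed.

Lemma syl_cong_catCA (b : letter) s x y :
    (forall a, a \in s -> val a <= val b) ->
    (forall c, c \in x -> val b < val c) ->
  cong syl_rel (s ++ x ++ b :: y) (x ++ s ++ b :: y).
Proof.
move=> sb; elim: x => [|c x IHx] bx /=; first exact: cong_refl.
apply: cong_trans (syl_cong_move x y sb (bx c (mem_head c x))) _.
apply: (@cong_cat _ _ [:: c] [:: c]); first exact: cong_refl.
by apply: IHx => d dx; apply: bx; rewrite inE dx orbT.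
Qed.

(** Choosing the first occurrence of the minimum makes the inequality on [x] strict, as [b < c] in
    the defining relation demands. In the induction a tie is therefore won by the head [a]. *)
Lemma split_first_min (w : seq letter) : w != [::] ->
  exists x b y, [/\ w = x ++ b :: y, forall c, c \in x -> val b < val c
    & forall c, c \in w -> val b <= val c].
Proof.
elim: w => // a [|d w] IHw _.
  by exists [::], a, [::]; split=> // c; rewrite inE => /eqP->.
have [//|x [b [y [-> bx bw]]]] := IHw.
have [ab|ba] := leqP (val a) (val b).
  exists [::], a, (x ++ b :: y); split=> // c; rewrite inE => /predU1P[->//|].
  by move/bw; exact: leq_trans.
exists (a :: x), b, y; split=> // c; rewrite inE => /predU1P[->|] //.
- exact: bx.
- exact: ltnW.
- exact: bw.
Qed.

Lemma syl_p_conj_shift (b : letter) s x y :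
    (forall a, a \in s -> val a <= val b) ->
    (forall c, c \in x -> val b < val c) ->
  p_conj (sylv_of (s ++ x ++ b :: y)) (sylv_of (rcons s b ++ y ++ x)).
Proof.
move=> sb bx; have /wclassP-> := syl_cong_catCA y sb bx.
by rewrite cat_rcons -cat_cons (catA s); exact: p_conj_wclass_catC.
Qed.

(** Induction on the size of [w], with [s] the sorted prefix already shared by both words: one shift
    of each word appends their common minimum to [s] and shortens both remainders. *)
Lemma perm_p_conj_star (w w' s : seq letter) : perm_eq w w' ->
    (forall a c, a \in s -> c \in w -> val a <= val c) ->
  p_conj_star (sylv_of (s ++ w)) (sylv_of (s ++ w')).
Proof.
have [n] := ubnP (size w).
elim: n w w' s => // n IHn w w' s; rewrite ltnS => wn ww' sw.
have [w0|w_neq0] := eqVneq w [::].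
  move: ww'; rewrite w0 perm_sym => /perm_nilP->.
  exact: p_conj_star_refl.
have w'_neq0 : w' != [::].
  by rewrite -size_eq0 -(perm_size ww') size_eq0.
have [x [b [y [wE bx bw]]]] := split_first_min w_neq0.
have [x' [b' [y' [w'E bx' bw']]]] := split_first_min w'_neq0.
have b_in : b \in w by rewrite wE mem_cat mem_head orbT.
have b'_in : b' \in w' by rewrite w'E mem_cat mem_head orbT.
(* Each of [b] and [b'] occurs in both words and is minimal in its own. *)
have bb' : b' = b.
  apply/val_inj/anti_leq; rewrite bw' -?(perm_mem ww') //=.
  by rewrite bw // (perm_mem ww').
rewrite {}bb' in w'E bx' *.
have sb a : a \in s -> val a <= val b by move=> /sw; apply.
(* Rotating [w] and [w'] brings [b] to the front of both, where it cancels. *)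
have yx : perm_eq (y ++ x) (y' ++ x').
  rewrite -(perm_cons b) -!cat_cons perm_catC perm_sym perm_catC perm_sym.
  by rewrite -wE -w'E.
apply: (@t_trans _ _ _ (sylv_of (rcons s b ++ y ++ x))).
  by rewrite wE; apply: t_step; exact: syl_p_conj_shift.
(* The shift of [w'] is traversed backwards, by symmetry. *)
apply: (@t_trans _ _ _ (sylv_of (rcons s b ++ y' ++ x'))); last first.
  by rewrite w'E; apply/p_conj_star_sym/t_step; exact: syl_p_conj_shift.
apply: IHn => //.
  by move: wn; rewrite wE !size_cat /= addnS addnC.
have sub_w c : c \in y ++ x -> c \in w.
  by rewrite wE !mem_cat inE => /orP[]->; rewrite ?orbT.
move=> a c; rewrite mem_rcons inE => /predU1P[->|/sw ac] /sub_w //.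
- exact: bw.
- exact: ac.
Qed.

Lemma content_p_conj_star (x y : sylvester) :
  content x =1 content y -> p_conj_star x y.
Proof.
elim/wclass_ind: x => u; elim/wclass_ind: y => v uv.
apply: (@perm_p_conj_star u v [::]) => //.
(* [perm_eq] unfolds to equality of counts on the letters of [u ++ v]. *)
by apply/allP => a _ /=; apply/eqP; have := uv a; rewrite !content_sylv_of.
Qed.

Lemma o_conjE (x y : sylvester) : o_conj x y <-> content x =1 content y.
Proof.
split; first exact: o_conj_content.
by move/content_p_conj_star/p_conj_star_o_conj.
Qed.

(** * Closure properties of recursive functions *)

(* Arguments are read off a sequence, so that they can be dropped or reordered
   without dependent types; only sequences of size n matter. *)
Definition computable n (F : seq nat -> nat) : Prop :=
  exists f : recf n, forall v : n.-tuple nat, eval f v (F v).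

Lemma computable_comp m n F (G : 'I_m -> seq nat -> nat) :
    computable m F -> (forall i, computable n (G i)) ->
  computable n (fun v => F [seq G i v | i <- enum 'I_m]).
Proof.
move=> [f fP] /choice[g gP]; exists (rcomp f g) => v /=.
exists [tuple G i v | i < m]; split=> [i|]; last exact: fP.
by rewrite tnth_mktuple; exact: gP.
Qed.

Lemma computable_ext n (F G : seq nat -> nat) :
    (forall v : n.-tuple nat, F v = G v) -> computable n F -> computable n G.
Proof. by move=> FG [f fP]; exists f => v; rewrite -FG. Qed.

Lemma computable_var n i : i < n -> computable n (nth 0 ^~ i).
Proof.
move=> lt_in; exists (rproj (Ordinal lt_in)) => v /=.
by rewrite (tnth_nth 0).
Qed.

Lemma computable0 n : computable n (fun=> 0).
Proof. by exists (rzero n). Qed.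

Lemma computableS n F : computable n F -> computable n (fun v => (F v).+1).
Proof.
move=> F_comp.
have S_comp : computable 1 (fun v => (nth 0 v 0).+1).
  by exists rsucc => v; rewrite /= /thead (tnth_nth 0).
apply: computable_ext (computable_comp S_comp (fun=> F_comp)) => v.
by rewrite enum_ordSl.
Qed.

(** Lets a function of the parameters ignore the counter and the accumulator that a recursion step
    puts before them. *)
Lemma computable_drop k n F :
  computable n F -> computable (k + n) (fun v => F (drop k v)).
Proof.
move=> F_comp.
have var_comp (i : 'I_n) : computable (k + n) (nth 0 ^~ (k + i)).
  by apply: computable_var; rewrite ltn_add2l.
apply: computable_ext (computable_comp F_comp var_comp) => v; congr F.
apply: (@eq_from_nth _ 0) => [|i].
  by rewrite size_map size_enum_ord size_drop size_tuple addKn.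
rewrite size_map size_enum_ord => lt_in.
have i0 : 'I_n by exact: Ordinal lt_in.
by rewrite (nth_map i0) ?size_enum_ord // nth_drop nth_enum_ord.
Qed.

(** Primitive recursion in the form in which the arithmetic below is built up: entries 0 and 1 of
    [w] are the counter and the previous value, in the order that [rprec] passes them. *)
Lemma computable_iteri n N base (step : nat -> nat -> seq nat -> nat) :
    computable n N -> computable n base ->
    computable n.+2 (fun w => step (nth 0 w 0) (nth 0 w 1) (drop 2 w)) ->
  computable n (fun v => iteri (N v) (fun i r => step i r v) (base v)).
Proof.
move=> N_comp [f fP] [g gP].
pose F w :=
  iteri (nth 0 w 0) (fun i r => step i r (drop 1 w)) (base (drop 1 w)).
have F_comp : computable n.+1 F.
  exists (rprec f g) => v; rewrite /= /F /thead (tnth_nth 0) /=.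
  have -> : drop 1 v = behead_tuple v by rewrite drop1.
  exists (fun i => iteri i (fun i r => step i r (behead_tuple v))
    (base (behead_tuple v))).
  split=> [|i _|//]; first exact: fP.
  by have := gP [tuple of i :: iteri i (fun i r => step i r (behead_tuple v))
    (base (behead_tuple v)) :: behead_tuple v]; rewrite /= drop0.
(* [rprec] recurses on its first argument, so composition with [G] puts [N v] in front of [v]. *)
pose G (i : 'I_n.+1) v := if val i is j.+1 then nth 0 v j else N v.
have G_comp i : computable n (G i).
  by case: i => -[|j] ltj //; exact: computable_var.
apply: computable_ext (computable_comp F_comp G_comp) => v.
rewrite enum_ordSl /= /F /= drop0 -map_comp.
suff -> : [seq (G (lift ord0 i) v) | i <- enum 'I_n] = v by [].
by rewrite -[RHS]map_tnth_enum; apply: eq_map => i; rewrite /= (tnth_nth 0).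
Qed.

(** A loop that returns its counter ends with the last counter value, or with the base 0 if it never
    runs. *)
Lemma computable_pred n F : computable n F -> computable n (fun v => (F v).-1).
Proof.
move=> F_comp; have := @computable_iteri n F (fun=> 0) (fun i _ _ => i) F_comp.
move=> /(_ (computable0 n) (computable_var (ltn0Sn _))).
by apply: computable_ext => v; case: (F v).
Qed.

Section Arithmetic.
Variables (n : nat) (F G : seq nat -> nat).
Hypotheses (F_comp : computable n F) (G_comp : computable n G).

Lemma computable_add : computable n (fun v => F v + G v).
Proof.
have := @computable_iteri n F G (fun _ r _ => r.+1) F_comp G_comp.
move=> /(_ (computableS (computable_var (isT : 1 < n.+2)))).
by apply: computable_ext => v; elim: (F v) => //= k ->.
Qed.

Lemma computable_sub : computable n (fun v => F v - G v).
Proof.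
have := @computable_iteri n G F (fun _ r _ => r.-1) G_comp F_comp.
move=> /(_ (computable_pred (computable_var (isT : 1 < n.+2)))).
apply: computable_ext => v.
by elim: (G v) => [|k] /=; rewrite ?subn0 // subnS => ->.
Qed.

End Arithmetic.

Lemma computable_mul n F G :
  computable n F -> computable n G -> computable n (fun v => F v * G v).
Proof.
move=> F_comp G_comp.
have := @computable_iteri n F (fun=> 0) (fun _ r v => G v + r) F_comp.
move=> /(_ (computable0 n)); move/(_ (computable_add
  (computable_drop 2 G_comp) (computable_var (isT : 1 < n.+2)))).
by apply: computable_ext => v; elim: (F v) => //= k ->.
Qed.

(** Truncated subtraction [1 - F v] is the indicator of [F v = 0]. *)
Lemma computable_not n F (b : seq nat -> bool) :
  computable n F -> (forall v, b v = (F v == 0)) -> computable n b.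
Proof.
move=> F_comp bF.
have := computable_sub (computableS (computable0 n)) F_comp.
by apply: computable_ext => v; rewrite bF; case: (F v).
Qed.

Lemma computable_eq n F G :
  computable n F -> computable n G -> computable n (fun v => F v == G v).
Proof.
move=> F_comp G_comp.
apply: computable_not (computable_add (computable_sub F_comp G_comp)
  (computable_sub G_comp F_comp)) _ => v.
by rewrite addn_eq0 !subn_eq0 -eqn_leq.
Qed.

Lemma computable_negb n (b : seq nat -> bool) :
  computable n b -> computable n (fun v => ~~ b v).
Proof. by move=> b_comp; apply: computable_not b_comp _ => v; case: b. Qed.

Lemma computable_odd n F : computable n F -> computable n (fun v => odd (F v)).
Proof.
move=> F_comp.
have := @computable_iteri n F (fun=> 0) (fun _ r _ => r == 0) F_comp.
move=> /(_ (computable0 n)); move/(_ (computable_eq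
  (computable_var (isT : 1 < n.+2)) (computable0 _))).
by apply: computable_ext => v; elim: (F v) => //= k ->; case: odd.
Qed.

(** The half of a number is the number of odd integers below it. *)
Lemma computable_half n F : computable n F -> computable n (fun v => (F v)./2).
Proof.
move=> F_comp.
have := @computable_iteri n F (fun=> 0) (fun i r _ => odd i + r) F_comp.
move=> /(_ (computable0 n)); move/(_ (computable_add (computable_odd
  (computable_var (isT : 0 < n.+2))) (computable_var (isT : 1 < n.+2)))).
by apply: computable_ext => v; elim: (F v) => //= k ->; rewrite uphalf_half.
Qed.

(** * Letter counts from binary codes *)

Definition bit (i x : nat) : bool := odd (iter i half x).

(* The number of zeros directly below bit i, which is the letter that a one at
   position i stands for. *)
Definition zero_run (i x : nat) : nat :=
  iteri i (fun j r => (~~ bit j x) * r.+1) 0.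

(** Counts the ones among the lowest [N] bits that stand for the letter [a]. Keeping [N] apart from
    [x] lets the tail of a word be read with fewer bits. *)
Definition code_count (a N x : nat) : nat :=
  iteri N (fun i r => bit i x * (zero_run i x == a) + r) 0.

Lemma zero_runS i x : zero_run i.+1 x = ~~ bit i x * (zero_run i x).+1.
Proof. by []. Qed.

Lemma code_countS a N x :
  code_count a N.+1 x = bit N x * (zero_run N x == a) + code_count a N x.
Proof. by []. Qed.

(** The bound [x + y] suffices for codes, since every letter of a word is smaller than its code. *)
Definition same_counts (x y : nat) : bool :=
  iteri (x + y) (fun a r => (code_count a x x != code_count a y y) + r) 0 == 0.

Lemma computable_bit n I X : computable n I -> computable n X ->
  computable n (fun v => bit (I v) (X v)).
Proof.
move=> I_comp X_comp; apply: computable_odd.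
have := @computable_iteri n I X (fun _ r _ => r./2) I_comp X_comp.
move=> /(_ (computable_half (computable_var (isT : 1 < n.+2)))).
by apply: computable_ext => v; elim: (I v) => //= k ->.
Qed.

Lemma computable_zero_run n I X : computable n I -> computable n X ->
  computable n (fun v => zero_run (I v) (X v)).
Proof.
move=> I_comp X_comp.
apply: (@computable_iteri n I (fun=> 0) (fun j r v => (~~ bit j (X v)) * r.+1)).
- exact: I_comp.
- exact: computable0.
apply: computable_mul; last exact/computableS/computable_var.
apply: computable_negb; apply: computable_bit; first exact: computable_var.
exact: (computable_drop 2 X_comp).
Qed.

Lemma computable_code_count n A N X :
    computable n A -> computable n N -> computable n X ->
  computable n (fun v => code_count (A v) (N v) (X v)).
Proof.
move=> A_comp N_comp X_comp.
apply: (@computable_iteri n N (fun=> 0)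
  (fun i r v => bit i (X v) * (zero_run i (X v) == A v) + r)).
- exact: N_comp.
- exact: computable0.
have X2_comp := computable_drop 2 X_comp.
apply: computable_add; last exact: computable_var.
apply: computable_mul.
  by apply: computable_bit X2_comp; exact: computable_var.
apply: computable_eq (computable_drop 2 A_comp).
by apply: computable_zero_run X2_comp; exact: computable_var.
Qed.

Lemma computable_same_counts :
  computable 2 (fun v => same_counts (nth 0 v 0) (nth 0 v 1)).
Proof.
have x_comp := computable_var (isT : 0 < 2).
have y_comp := computable_var (isT : 1 < 2).
apply: computable_eq (computable0 _).
apply: (@computable_iteri 2 _ (fun=> 0) (fun a r v =>
  (code_count a (nth 0 v 0) (nth 0 v 0) != code_count a (nth 0 v 1) (nth 0 v 1))
    + r)).
- exact: computable_add.
- exact: computable0.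
apply: computable_add; last exact: computable_var.
apply/computable_negb/computable_eq.
  by apply: computable_code_count (computable_drop 2 x_comp)
    (computable_drop 2 x_comp); exact: computable_var.
by apply: computable_code_count (computable_drop 2 y_comp)
  (computable_drop 2 y_comp); exact: computable_var.
Qed.

Lemma iter_half n x : iter n half x = x %/ 2 ^ n.
Proof. by elim: n => [|n /= ->]; rewrite ?divn1 // -divn2 -divnMA expnSr. Qed.

(** * Bits of the code of a nonempty word *)

Section CodeCons.
Variables (n c : nat).
(** If [c] encodes [s], this is the code of [n :: s]: [n] zeros, a one, then the bits of [c]. *)
Let x := 2 ^ n * c.*2.+1.

Lemma bit_code_zero i : i < n -> bit i x = false.
Proof.
move=> lt_in; rewrite /bit iter_half /x -(subnKC lt_in) addSnnS expnD -mulnA.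
by rewrite mulKn ?expn_gt0 // expnS -mulnA oddM.
Qed.

Lemma bit_code_one : bit n x.
Proof. by rewrite /bit iter_half mulKn ?expn_gt0 //= odd_double. Qed.

Lemma bit_code_add i : bit (n.+1 + i) x = bit i c.
Proof.
rewrite /bit addnC iterD iterS [iter n _ _]iter_half mulKn ?expn_gt0 //=.
by rewrite uphalf_double.
Qed.

Lemma zero_run_code_le i : i <= n -> zero_run i x = i.
Proof.
by elim: i => //= i IHi lt_in; rewrite bit_code_zero // mul1n IHi // ltnW.
Qed.

(** The one at position [n] resets the run to 0, the value with which [zero_run] starts on [c]. *)
Lemma zero_run_code_add i : zero_run (n.+1 + i) x = zero_run i c.
Proof.
elim: i => [|i IHi]; first by rewrite addn0 zero_runS bit_code_one.
by rewrite addnS (zero_runS (_ + _)) (zero_runS i) bit_code_add IHi.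
Qed.

Lemma code_count_le a i : i <= n -> code_count a i x = 0.
Proof.
by elim: i => //= i IHi lt_in; rewrite bit_code_zero // IHi // ltnW.
Qed.

Lemma code_count_add a N :
  code_count a (n.+1 + N) x = (n == a) + code_count a N c.
Proof.
elim: N => [|N IHN].
  rewrite addn0 code_countS bit_code_one.
  by rewrite zero_run_code_le // code_count_le // mul1n.
rewrite addnS (code_countS a (_ + _)) (code_countS a N) bit_code_add.
by rewrite zero_run_code_add IHN addnCA.
Qed.

End CodeCons.

Lemma code_count_code a N s :
  CodeSeq.code s < 2 ^ N -> code_count a N (CodeSeq.code s) = count_mem a s.
Proof.
elim: s N => [|n s IHs] N.
  by move=> _; elim: N => //= N IHN; rewrite /bit iter_half div0n.
set c := CodeSeq.code s in IHs *; rewrite [CodeSeq.code _]/= -/c => lt_xN.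
have lt_nN : n < N.
  rewrite -(ltn_exp2l n N (isT : 1 < 2)); apply: leq_ltn_trans lt_xN.
  by rewrite leq_pmulr.
rewrite -(subnKC lt_nN) code_count_add IHs //.
(* Cancelling [2 ^ n] leaves [2c + 1 < 2 * 2 ^ (N - n - 1)], the bound required for the tail. *)
move: lt_xN; rewrite -{1}(subnKC lt_nN) addSnnS expnD ltn_pmul2l ?expn_gt0 //.
by rewrite expnS mul2n => /ltnW; rewrite ltn_double.
Qed.

Lemma mem_code_lt n s : n \in s -> n < CodeSeq.code s.
Proof.
elim: s => // m s IHs; rewrite inE => /predU1P[->|/IHs lt_ns] /=.
  by apply: leq_trans (ltn_expl m (isT : 1 < 2)) _; rewrite leq_pmulr.
apply: leq_trans (leq_pmull _ (_ : 0 < 2 ^ m)); last by rewrite expn_gt0.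
by apply: leq_trans lt_ns _; rewrite -addnn leqW // leq_addr.
Qed.

Lemma same_countsP s t :
  reflect (forall a, count_mem a s = count_mem a t)
          (same_counts (CodeSeq.code s) (CodeSeq.code t)).
Proof.
have counts a r :
    code_count a (CodeSeq.code r) (CodeSeq.code r) = count_mem a r.
  by apply: code_count_code; exact: ltn_expl.
(* A sum of indicators vanishes exactly when all of them do. *)
have iterE N (b : nat -> bool) :
    (iteri N (fun a r => b a + r) 0 == 0) = all (predC b) (iota 0 N).
  elim: N => // N IHN; rewrite -addn1 iotaD all_cat addn1 /= addn_eq0 IHN.
  by rewrite andbT andbC eqb0.
rewrite /same_counts iterE; apply: (iffP allP) => [st a|st a _]; last first.
  by rewrite /= negbK !counts st.
have [lt_a|ge_a] := ltnP a (CodeSeq.code s + CodeSeq.code t).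
  by apply/eqP; rewrite -!counts -[_ == _]negbK; apply: st; rewrite mem_iota.
have not_in r : CodeSeq.code r <= a -> count_mem a r = 0.
  move=> le_ra; apply/count_memPn; apply: contraL le_ra => /mem_code_lt.
  by rewrite ltnNge.
by rewrite !not_in // (leq_trans _ ge_a) ?leq_addl ?leq_addr.
Qed.

Lemma same_counts_content u v :
  same_counts (code_word u) (code_word v) <-> word_content u =1 word_content v.
Proof.
have count_val w (a : letter) :
    count_mem (val a) (map val w) = word_content w a.
  by rewrite count_map; apply: eq_count => b /=; rewrite (inj_eq val_inj).
split=> [/same_countsP uv a|uv]; first by rewrite -!count_val uv.
apply/same_countsP => -[|a].
  by rewrite !count_map !(@eq_count _ _ pred0) ?count_pred0 // => -[[]].
by have := uv (exist _ a.+1 isT); rewrite -!count_val.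
Qed.

(** * Decidability of o-conjugacy and its equality with the closure of p-conjugacy *)

Lemma word_decidable_o_conj :
  word_decidable (fun u v => o_conj (sylv_of u) (sylv_of v)).
Proof.
have [f fP] := computable_same_counts; exists f => u v.
have uvE : o_conj (sylv_of u) (sylv_of v) <->
    same_counts (code_word u) (code_word v).
  rewrite same_counts_content o_conjE.
  by split=> uv a; have := uv a; rewrite !content_sylv_of.
have := fP [tuple code_word u; code_word v]; rewrite /=.
by case: same_counts uvE => -[uv vu] f_uv; split=> [/uv|] // []; exact: vu.
Qed.

Theorem theorem3p4 :
  (forall x y : sylvester, o_conj x y <-> content x =1 content y) /\
  word_decidable (fun u v => o_conj (sylv_of u) (sylv_of v)) /\
  (forall x y : sylvester, o_conj x y <-> p_conj_star x y).
Proof.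
split; first exact: o_conjE.
split; first exact: word_decidable_o_conj.
move=> x y; split=> [/o_conj_content/content_p_conj_star //|].
exact: p_conj_star_o_conj.
Qed.
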